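(* Let $m,n\in\mathbb{N}$ and let $X,Y$ be Banach spaces. For every $P\in\mathcal{P}(^mX;Y)$ we have $\tilde d_n(P)=d_n(P_L)$.
   Context: Banach spaces are over $\mathbb{K}=\mathbb{R}$ or $\mathbb{C}$; $\mathbb{N}$ is the set of positive integers; $\overline{B}_X$ is the closed unit ball of $X$. $\mathcal{P}(^mX;Y)$ is the space of continuous $m$-homogeneous polynomials $P:X\to Y$, i.e. maps $P(x)=A(x,\ldots,x)$ with $A:X\times\cdots\times X\to Y$ a continuous $m$-linear map, and $\mathcal{L}(X;Y)=\mathcal{P}(^1X;Y)$. $\hat\otimes_{m,s}^{\pi_s}X$ denotes the completed $m$-fold symmetric projective tensor product of $X$: the completion of the linear span of the tensors $\otimes_m x=x\otimes\cdots\otimes x$ ($x\in X$) under the norm $\pi_s(z)=\inf\{\sum_i|\lambda_i|\,\|x_i\|^m: z=\sum_i\lambda_i\otimes_m x_i \text{ (finite sum)}\}$. The linearization $P_L:\hat\otimes_{m,s}^{\pi_s}X\to Y$ of $P$ is the unique continuous linear operator with $P_L(\otimes_m x)=P(x)$ for all $x\in X$. The $n$-th Kolmogorov number of $P\in\mathcal{P}(^mX;Y)$ is $\tilde d_n(P)=\inf\{\varepsilon>0: P(\overline{B}_X)\subset N_\varepsilon+\varepsilon\overline{B}_Y \text{ for some linear subspace } N_\varepsilon\subset Y \text{ with } \dim N_\varepsilon<n\}$; for a linear operator $T$ (the case $m=1$) one writes $d_n(T)$ for this number. *)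

(* Defs.v *)
From HB Require Import structures.
From mathcomp Require Import all_boot all_order all_algebra generic_quotient.
From mathcomp Require Import ring_quotient complex.
From mathcomp Require Import all_classical all_reals all_analysis.

Set Implicit Arguments.
Unset Strict Implicit.
Unset Printing Implicit Defensive.

Import Order.TTheory GRing.Theory Num.Theory.
Import numFieldNormedType.Exports.

Local Open Scope classical_set_scope.
Local Open Scope ring_scope.

Variant scalar_kind := RealScalars | ComplexScalars.

Definition scalars (R : realType) (k : scalar_kind) : numFieldType :=
  match k with
  | RealScalars => R : numFieldType
  | ComplexScalars => R[i] : numFieldType
  end.

Definition of_real (R : realType) (k : scalar_kind) : R -> scalars R k :=
  match k return R -> scalars R k with
  | RealScalars => fun x => x
  | ComplexScalars => fun x => Complex x 0
  end.

Definition re_part (R : realType) (k : scalar_kind) : scalars R k -> R :=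
  match k return scalars R k -> R with
  | RealScalars => fun x => x
  | ComplexScalars => fun z => complex.Re z
  end.

Arguments of_real {R k} x.
Arguments re_part {R k} z.

(* MathComp-Analysis norms take their values in the scalar field, hence in
   [R[i]] in the complex case; [rnorm] is the same norm read in [R]. *)
Definition rnorm (R : realType) (k : scalar_kind)
    (V : normedZmodType (scalars R k)) (x : V) : R :=
  re_part `|x|.

Section ScalarLemmas.
Variables (R : realType) (k : scalar_kind).
Local Notation K := (scalars R k).
Implicit Types (x y : R) (z : K).

Lemma of_realK : cancel (@of_real R k) re_part.
Proof. by case: k. Qed.

Lemma of_realD x y : of_real (x + y) = of_real x + of_real y :> K.
Proof. by case: k => //; exact: (rmorphD (real_complex R)). Qed.

Lemma of_realM x y : of_real (x * y) = of_real x * of_real y :> K.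
Proof. by case: k => //; exact: (rmorphM (real_complex R)). Qed.

Lemma of_real0 : of_real 0 = 0 :> K.
Proof. by case: k. Qed.

Lemma of_real_le x y : (of_real x <= of_real y :> K) = (x <= y).
Proof. by case: k => //; exact: lecR. Qed.

Lemma of_real_lt x y : (of_real x < of_real y :> K) = (x < y).
Proof. by case: k => //; exact: ltcR. Qed.

Lemma re_partK z : 0 <= z -> of_real (re_part z) = z.
Proof.
case: k z => //= z /ger0_Im z0; apply/eqP.
by rewrite eq_complex /= z0 !eqxx.
Qed.

Lemma rnormE (V : normedZmodType K) (v : V) : of_real (rnorm v) = `|v|.
Proof. exact: re_partK. Qed.

Lemma rnorm_ge0 (V : normedZmodType K) (v : V) : 0 <= rnorm v.
Proof. by rewrite -of_real_le rnormE of_real0. Qed.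

Lemma rnorm0 (V : normedZmodType K) : rnorm (0 : V) = 0.
Proof.
by apply: (can_inj of_realK); rewrite rnormE normr0 of_real0.
Qed.

Lemma rnorm_scalarM (a b : K) : rnorm (a * b) = rnorm a * rnorm b.
Proof.
by apply: (can_inj of_realK); rewrite of_realM !rnormE normrM.
Qed.

Lemma rnorm_scalar1 : rnorm (1 : K) = 1.
Proof. by apply: (can_inj of_realK); rewrite rnormE normr1; case: k. Qed.

Lemma rnormN1 : rnorm (- 1 : K) = 1.
Proof. by rewrite -rnorm_scalar1 /rnorm normrN. Qed.

End ScalarLemmas.

Record seminorm (R : realType) (k : scalar_kind) (V : lmodType (scalars R k)) :=
  Seminorm {
    seminorm_fun :> V -> R;
    seminormD : forall x y, seminorm_fun (x + y) <= seminorm_fun x + seminorm_fun y;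
    seminormZ : forall a x, seminorm_fun (a *: x) = rnorm a * seminorm_fun x
  }.

Section SeminormTheory.
Variables (R : realType) (k : scalar_kind) (V : lmodType (scalars R k)).
Variable p : seminorm V.
Implicit Types x y : V.

Lemma seminorm0 : p 0 = 0.
Proof. by rewrite -(scale0r 0) seminormZ rnorm0 mul0r. Qed.

Lemma seminormN x : p (- x) = p x.
Proof. by rewrite -scaleN1r seminormZ rnormN1 mul1r. Qed.

Lemma seminormB x y : p (x - y) = p (y - x).
Proof. by rewrite -seminormN opprB. Qed.

Lemma seminorm_ge0 x : 0 <= p x.
Proof.
have := seminormD p x (- x); rewrite subrr seminorm0 seminormN -mulr2n.
by rewrite pmulrn_lge0.
Qed.

Lemma seminorm_dist x y : `|p x - p y| <= p (x - y).
Proof.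
have H u v : p u <= p (u - v) + p v.
  by rewrite -{1}(subrK v u) seminormD.
rewrite ler_norml lerBlDr H andbT lerNl opprB lerBlDr seminormB.
exact: H.
Qed.

End SeminormTheory.

Section CauchySequences.
Variables (R : realType) (k : scalar_kind) (V : lmodType (scalars R k)).
Variable p : seminorm V.
Local Notation K := (scalars R k).

(* [completion p] consists of the Cauchy sequences for the seminorm p modulo
   those along which p tends to 0, normed by the limit of p. *)
Definition is_cauchy : pred (nat -> V) := fun u =>
  `[< forall e : R, 0 < e ->
      exists N, forall i j, (N <= i)%N -> (N <= j)%N -> p (u i - u j) < e >].

Lemma is_cauchy_submod : submod_closed is_cauchy.
Proof.
split=> [|a u v /asboolP cu /asboolP cv]; apply/asboolP => e e0.
  by exists 0%N => i j _ _; rewrite subrr seminorm0.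
pose M := rnorm a + 1.
have M0 : 0 < M by rewrite ltr_wpDl ?rnorm_ge0.
have [N HN] := cu (e / 2 / M) ltac:(by rewrite !divr_gt0).
have [N' HN'] := cv (e / 2) ltac:(by rewrite !divr_gt0).
exists (maxn N N') => i j; rewrite !geq_max => /andP[iN iN'] /andP[jN jN'].
have -> : (a *: u + v) i - (a *: u + v) j = a *: (u i - u j) + (v i - v j).
  by rewrite scalerBr opprD addrACA.
apply: (le_lt_trans (seminormD _ _ _)); rewrite seminormZ (splitr e).
apply: ler_ltD; last exact: HN'.
apply: (@le_trans _ _ (M * p (u i - u j))).
  by rewrite ler_wpM2r ?seminorm_ge0 // lerDl.
by rewrite mulrC -ler_pdivlMr // ltW // HN.
Qed.

HB.instance Definition _ :=
  GRing.isSubmodClosed.Build K (nat -> V) is_cauchy is_cauchy_submod.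

Record cauchy_seq := CauchySeq {
  cauchy_fun :> nat -> V;
  _ : cauchy_fun \in is_cauchy
}.

HB.instance Definition _ := [isSub for cauchy_fun].
HB.instance Definition _ := [Choice of cauchy_seq by <:].
HB.instance Definition _ := [SubChoice_isSubLmodule of cauchy_seq by <:].

Definition lim_seminorm (u : cauchy_seq) : R := limn (fun i => p (u i)).

Lemma cauchy_seqP (u : cauchy_seq) (e : R) : 0 < e ->
  exists N, forall i j, (N <= i)%N -> (N <= j)%N -> p (u i - u j) < e.
Proof.
by case: u => u cu; move/asboolP: (cu); apply.
Qed.

Lemma lim_seminorm_cvg (u : cauchy_seq) :
  (fun i => p (u i)) @ \oo --> lim_seminorm u.
Proof.
suff : cvgn (fun i => p (u i)) by [].
apply/cauchy_cvgP/cauchy_exP => e e0.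
have [N HN] := cauchy_seqP u e0.
exists (p (u N)); exists N => // i /= Ni.
by rewrite /ball /= (le_lt_trans (seminorm_dist _ _ _)) // HN.
Qed.

Lemma lim_seminorm_le (u : cauchy_seq) (c : R) :
  (\forall i \near \oo, p (u i) <= c) -> lim_seminorm u <= c.
Proof.
move=> H; have cc : (fun=> c) @ \oo --> c by exact: cvg_cst.
exact: (ler_cvg_to (@lim_seminorm_cvg u) cc H).
Qed.

Lemma lim_seminormD (u v : cauchy_seq) :
  lim_seminorm (u + v) <= lim_seminorm u + lim_seminorm v.
Proof.
have cu := @lim_seminorm_cvg u; have cv := @lim_seminorm_cvg v.
have cuv := @lim_seminorm_cvg (u + v).
apply: (ler_cvg_to cuv (cvgD cu cv)).
by near=> i => /=; exact: seminormD.
Unshelve. all: by end_near. Qed.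

Lemma lim_seminormZ a (u : cauchy_seq) :
  lim_seminorm (a *: u) = rnorm a * lim_seminorm u.
Proof.
have cu := @lim_seminorm_cvg u.
apply/cvg_lim => //.
rewrite (_ : (fun i => _) = (fun i => rnorm a * p (u i))).
  by apply: cvgM => //; exact: cvg_cst.
by apply/funext => i; rewrite -seminormZ.
Qed.

Definition cauchy_seminorm := Seminorm lim_seminormD lim_seminormZ.

End CauchySequences.

Section Completion.
Variables (R : realType) (k : scalar_kind) (V : lmodType (scalars R k)).
Variable p : seminorm V.
Local Notation K := (scalars R k).
Local Notation C := (cauchy_seq p).
Local Notation pC := (cauchy_seminorm p).

Definition is_null : pred C := fun u => lim_seminorm u == 0.

Lemma is_null_zmod : zmod_closed is_null.
Proof.
split; first by rewrite unfold_in; apply/eqP/(seminorm0 pC).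
move=> u v /eqP u0 /eqP v0; rewrite unfold_in.
rewrite eq_le (seminorm_ge0 pC) andbT.
have := seminormD pC u (- v); rewrite (seminormN pC) /=.
by rewrite u0 v0 addr0.
Qed.

HB.instance Definition _ := GRing.isZmodClosed.Build C is_null is_null_zmod.

Definition null_pred : zmodClosed C := GRing.ZmodClosed.clone C is_null _.

Definition completion : Type := Quotient.quot null_pred.

HB.instance Definition _ := GRing.Zmodule.on completion.
HB.instance Definition _ := Choice.on completion.

Definition class (u : C) : completion := (\pi_(Quotient.quot null_pred) u)%qT.

Local Notation rep q := (repr (q : Quotient.quot null_pred)).

Lemma repK (q : completion) : class (rep q) = q.
Proof. exact: reprK. Qed.

Lemma classD u v : class (u + v) = class u + class v.
Proof. exact: (Quotient.pi_add null_pred). Qed.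

Lemma classN u : class (- u) = - class u.
Proof. exact: (Quotient.pi_opp null_pred). Qed.

Lemma class_eq u v : class u = class v <-> pC (u - v) = 0.
Proof.
rewrite /class; split.
  by move=> /eqP; rewrite -Quotient.idealrBE => /eqP.
by move=> /eqP uv; apply/eqP; rewrite -Quotient.idealrBE.
Qed.

Definition completion_scale (a : K) (q : completion) : completion :=
  class (a *: rep q).

Lemma class_scale a u : completion_scale a (class u) = class (a *: u).
Proof.
apply/class_eq; rewrite -scalerBr seminormZ.
suff -> : pC (rep (class u) - u) = 0 by rewrite mulr0.
by apply/class_eq; rewrite repK.
Qed.

Lemma completion_scaleA a b q :
  completion_scale a (completion_scale b q) = completion_scale (a * b) q.
Proof. by rewrite -[q]repK !class_scale scalerA. Qed.

Lemma completion_scale1 : left_id 1 completion_scale.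
Proof. by move=> q; rewrite -[q]repK class_scale scale1r. Qed.

Lemma completion_scaleDr : right_distributive completion_scale +%R.
Proof.
by move=> a q r; rewrite -[q]repK -[r]repK -classD !class_scale scalerDr classD.
Qed.

Lemma completion_scaleDl q : {morph completion_scale^~ q : a b / a + b}.
Proof. by move=> a b; rewrite -[q]repK !class_scale scalerDl classD. Qed.

HB.instance Definition _ := GRing.Zmodule_isLmodule.Build K completion
  completion_scaleA completion_scale1 completion_scaleDr completion_scaleDl.

Lemma classZ a u : class (a *: u) = a *: class u.
Proof. by rewrite -class_scale. Qed.

Definition completion_norm (q : completion) : K := of_real (pC (rep q)).

Lemma class_norm u : completion_norm (class u) = of_real (pC u).
Proof.
congr of_real; apply/eqP; rewrite -subr_eq0 -normr_le0.
rewrite (le_trans (seminorm_dist pC _ _)) //.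
by have /class_eq -> : class (rep (class u)) = class u by rewrite repK.
Qed.

Lemma completion_normD q r :
  completion_norm (q + r) <= completion_norm q + completion_norm r.
Proof.
rewrite -[q]repK -[r]repK -classD !class_norm -of_realD of_real_le.
exact: seminormD.
Qed.

Lemma completion_normZ a q :
  completion_norm (a *: q) = `|a| * completion_norm q.
Proof.
rewrite -[q]repK -classZ !class_norm seminormZ.
by rewrite of_realM rnormE.
Qed.

Lemma completion_norm0_eq0 q : completion_norm q = 0 -> q = 0.
Proof.
rewrite -[q]repK class_norm -(of_real0 R k) => /(can_inj (@of_realK R k)) q0.
have -> : 0 = class 0 by rewrite -[in RHS](subrr 0) classD classN subrr.
by apply/class_eq; rewrite subr0.
Qed.

HB.instance Definition _ := Lmodule_isNormed.Build K completion
  completion_normD completion_normZ completion_norm0_eq0.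

Lemma cst_is_cauchy (x : V) : (fun=> x) \in is_cauchy p.
Proof. by apply/asboolP => e e0; exists 0%N => i j _ _; rewrite subrr seminorm0. Qed.

Definition to_completion (x : V) : completion := class (CauchySeq (cst_is_cauchy x)).

Lemma to_completion_linear : linear to_completion.
Proof.
move=> a x y; rewrite /to_completion -classZ -classD.
by congr class; exact: val_inj.
Qed.

HB.instance Definition _ :=
  GRing.isLinear.Build K V completion _ to_completion to_completion_linear.

Lemma to_completion_norm x : rnorm (to_completion x) = p x.
Proof.
rewrite /rnorm [`|_|]class_norm of_realK /= /lim_seminorm.
rewrite (_ : (fun i => _) = (fun=> p x)) //.
exact: lim_cst.
Qed.

Lemma class_cvg (u : C) (e : R) : 0 < e ->
  exists N, forall i, (N <= i)%N -> rnorm (class u - to_completion (u i)) <= e.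
Proof.
move=> e0; have [N HN] := cauchy_seqP u e0.
exists N => i Ni; rewrite /to_completion -classN -classD.
rewrite /rnorm [`|_|]class_norm of_realK.
by apply: lim_seminorm_le; exists N => // j /= Nj; exact/ltW/HN.
Qed.

Lemma to_completion_dense (q : completion) (e : R) : 0 < e ->
  exists x, rnorm (q - to_completion x) <= e.
Proof.
move=> e0; have [N HN] := class_cvg (rep q) e0.
by exists (rep q N); rewrite -[q in q - _]repK HN.
Qed.

Lemma completion_complete (F : set_system completion) :
  ProperFilter F -> cauchy F -> cvg F.
Proof.
move=> FF /cauchyP cF.
pose d n : R := (n.+1%:R)^-1.
have d0 n : 0 < d n by rewrite invr_gt0.
have ballE (q r : completion) e : ball q (of_real e) r <-> rnorm (q - r) < e.
  by rewrite -[ball _ _ _]/(is_true (`|q - r| < _)) -rnormE of_real_lt.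
have d0K n : 0 < of_real (d n) :> K by rewrite -(of_real0 R k) of_real_lt.
have rD (q r : completion) : rnorm (q + r) <= rnorm q + rnorm r.
  by rewrite -(of_real_le k) of_realD !rnormE ler_normD.
have rB (q r : completion) : rnorm (q - r) = rnorm (r - q).
  by rewrite /rnorm distrC.
have rT (s q r : completion) : rnorm (q - r) <= rnorm (q - s) + rnorm (s - r).
  by rewrite -(subrKA s) rD.
have approx n : exists x, F [set q | rnorm (to_completion x - q) < d n *+ 2].
  have [q Fq] := cF _ (d0K n).
  have [x qx] := to_completion_dense q (d0 n).
  exists x; apply: filterS Fq => r /ballE qr /=.
  by rewrite (le_lt_trans (rT q _ _)) // mulr2n ler_ltD // rB.
have [v Fv] := choice approx.
have pv i j : p (v i - v j) < d i *+ 2 + d j *+ 2.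
  rewrite -to_completion_norm raddfB /=.
  have [q [/= qi qj]] := filter_ex (filterI (Fv i) (Fv j)).
  by rewrite (le_lt_trans (rT q _ _)) // ltrD // rB.
have small (e : R) : 0 < e -> exists N, forall i, (N <= i)%N -> d i *+ 4 < e.
  move=> e0; have [N _ HN] := near_infty_natSinv_lt (PosNum (divr_gt0 e0 (ltr0n _ 4))).
  exists N => i /HN; rewrite /= ltr_pdivlMr // mulr_natr; exact.
have vC : v \in is_cauchy p.
  apply/asboolP => e e0; have [N HN] := small e e0.
  exists N => i j iN jN; apply: (lt_le_trans (pv i j)).
  rewrite (splitr e) lerD // ltW // ltr_pdivlMr // mulr_natr -mulrnA; exact: HN.
apply/cvg_ex; exists (class (CauchySeq vC)).
apply/cvgrPdist_le => e e0.
pose e' := re_part e; have ee : e = of_real e' by rewrite re_partK // ltW.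
have e'0 : 0 < e' by rewrite -(of_real_lt k) -ee of_real0.
have e'20 : 0 < e' / 2 by rewrite divr_gt0.
have [N HN] := small _ e'20.
have [N' HN'] := class_cvg (CauchySeq vC) e'20.
pose i := maxn N N'.
apply: filterS (Fv i) => q /= vq.
rewrite ee -rnormE of_real_le (le_trans (rT (to_completion (v i)) _ _)) //.
rewrite (splitr e') lerD ?HN' ?leq_maxr // ltW // (lt_trans vq) //.
apply: (le_lt_trans _ (HN i _)); rewrite ?leq_maxl //.
by rewrite ler_pMn2l.
Qed.

HB.instance Definition _ :=
  Uniform_isComplete.Build completion completion_complete.

End Completion.

Definition multilinear (K : numFieldType) (m : nat) (X Y : lmodType K)
    (A : ('I_m -> X) -> Y) : Prop :=
  forall (i : 'I_m) (v : 'I_m -> X), linear (fun x : X => A (dfwith v i x)).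

Section SymmetricTensors.
Variables (R : realType) (k : scalar_kind).
Local Notation K := (scalars R k).
Variables (m : nat) (X : normedModType K).

Record multilinear_form := MultilinearForm {
  mform_fun :> ('I_m -> X) -> K^o;
  mform_multilinear : multilinear mform_fun
}.

(* The algebraic tensor power is realised inside the space of functionals on
   m-linear forms, the tensor x_1 (x) ... (x) x_m being the evaluation
   A |-> A (x_1, ..., x_m); only the diagonal tensors are needed here. No
   continuity is required of the forms, so two formal combinations of tensors
   give the same functional exactly when they are equal in the algebraic tensor
   power. *)
Definition diag_eval (x : X) : multilinear_form -> K^o := fun A => A (fun=> x).

Definition is_symtensor : pred (multilinear_form -> K^o) := fun z =>
  `[< exists s : seq (K * X), z = \sum_(t <- s) t.1 *: diag_eval t.2 >].

Lemma is_symtensor_submod : submod_closed is_symtensor.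
Proof.
split=> [|a z w /asboolP[s ->] /asboolP[s' ->]]; apply/asboolP.
  by exists [::]; rewrite big_nil.
exists ([seq (a * t.1, t.2) | t <- s] ++ s').
rewrite big_cat big_map scaler_sumr; congr (_ + _).
by apply: eq_bigr => t _; rewrite scalerA.
Qed.

HB.instance Definition _ := GRing.isSubmodClosed.Build K
  (multilinear_form -> K^o) is_symtensor is_symtensor_submod.

Record symtensor := SymTensor {
  symtensor_eval :> multilinear_form -> K^o;
  _ : symtensor_eval \in is_symtensor
}.

HB.instance Definition _ := [isSub for symtensor_eval].
HB.instance Definition _ := [Choice of symtensor by <:].
HB.instance Definition _ := [SubChoice_isSubLmodule of symtensor by <:].

Lemma diag_eval_symtensor x : diag_eval x \in is_symtensor.
Proof. by apply/asboolP; exists [:: (1, x)]; rewrite big_seq1 scale1r. Qed.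

Definition diag (x : X) : symtensor := SymTensor (diag_eval_symtensor x).

Local Notation cost s := (\sum_(t <- s) rnorm t.1 * rnorm t.2 ^+ m).
Local Notation costs z := [set cost s
  | s in [set s : seq (K * X) | z = \sum_(t <- s) t.1 *: diag t.2]].

Definition proj_norm (z : symtensor) : R := inf (costs z).

Lemma symtensor_decomp (z : symtensor) :
  exists s : seq (K * X), z = \sum_(t <- s) t.1 *: diag t.2.
Proof.
case: z => z z_sym; have /asboolP[s zE] := z_sym; exists s.
apply: val_inj; rewrite raddf_sum [LHS]zE.
by apply: eq_bigr => t _.
Qed.

Lemma cost_ge0 (s : seq (K * X)) : 0 <= cost s.
Proof.
by apply: sumr_ge0 => t _; rewrite mulr_ge0 ?exprn_ge0 ?rnorm_ge0.
Qed.

Lemma costs_has_inf z : has_inf (costs z).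
Proof.
split; last by exists 0 => _ [s _ <-]; exact: cost_ge0.
by have [s zs] := symtensor_decomp z; exists (cost s), s.
Qed.

Lemma proj_norm_le z (s : seq (K * X)) :
  z = \sum_(t <- s) t.1 *: diag t.2 -> proj_norm z <= cost s.
Proof.
by move=> zs; apply: ge_inf; [case: (costs_has_inf z) | exists s].
Qed.

Lemma proj_norm_lt z (e : R) : 0 < e -> exists2 s : seq (K * X),
  z = \sum_(t <- s) t.1 *: diag t.2 & cost s < proj_norm z + e.
Proof.
by move=> /inf_adherent/(_ (costs_has_inf z))[_ [s zs <-] lts]; exists s.
Qed.

Lemma proj_normD z w : proj_norm (z + w) <= proj_norm z + proj_norm w.
Proof.
apply/ler_addgt0Pr => e e0; have e20 : 0 < e / 2 by rewrite divr_gt0.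
have [s zs lts] := proj_norm_lt z e20.
have [s' ws' lts'] := proj_norm_lt w e20.
apply: (@le_trans _ _ (cost (s ++ s'))).
  by apply: proj_norm_le; rewrite big_cat -zs -ws'.
rewrite big_cat /= (splitr e) addrACA lerD // ltW //.
Qed.

Lemma proj_norm_scale_le a z : proj_norm (a *: z) <= rnorm a * proj_norm z.
Proof.
apply/ler_addgt0Pr => e e0.
have a1 : 0 < rnorm a + 1 by rewrite ltr_wpDl ?rnorm_ge0.
have [s zs lts] := proj_norm_lt z (divr_gt0 e0 a1).
apply: (@le_trans _ _ (cost [seq (a * t.1, t.2) | t <- s])).
  apply: proj_norm_le; rewrite big_map zs scaler_sumr.
  by apply: eq_bigr => t _; rewrite scalerA.
rewrite big_map /=.
under eq_bigr do rewrite rnorm_scalarM -mulrA.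
rewrite -mulr_sumr (le_trans (ler_wpM2l (rnorm_ge0 _) (ltW lts))) //.
rewrite mulrDr lerD2l mulrA ler_pdivrMr // mulrC ler_wpM2l ?ltW //.
by rewrite ltrDl.
Qed.

Lemma proj_normZ a z : proj_norm (a *: z) = rnorm a * proj_norm z.
Proof.
apply/eqP; rewrite eq_le proj_norm_scale_le /=.
have [->|a0] := eqVneq a 0.
  rewrite rnorm0 mul0r; apply: lb_le_inf; last by move=> _ [s _ <-]; exact: cost_ge0.
  by case: (costs_has_inf (0 *: z)).
have ra : rnorm a * rnorm a^-1 = 1.
  by rewrite -rnorm_scalarM divff // rnorm_scalar1.
have := proj_norm_scale_le a^-1 (a *: z).
rewrite scalerA mulVf // scale1r => /(ler_wpM2l (rnorm_ge0 a)).
by rewrite mulrA ra mul1r.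
Qed.

(* [proj_norm] is a norm, as Hahn-Banach shows; the completion only uses that
   it is a seminorm. *)
Definition proj_seminorm : seminorm symtensor := Seminorm proj_normD proj_normZ.

Definition sym_proj_tensor : completeNormedModType K := completion proj_seminorm.

Definition proj_diag (x : X) : sym_proj_tensor := to_completion proj_seminorm (diag x).

End SymmetricTensors.

Section Polynomials.
Variables (R : realType) (k : scalar_kind).
Local Notation K := (scalars R k).

Definition cont_homog_poly (m : nat) (X Y : normedModType K) (P : X -> Y) : Prop :=
  exists A : {ptws 'I_m -> X} -> Y,
    [/\ multilinear A, continuous A & forall x, P x = A (fun=> x)].

Definition is_linearization (m : nat) (X Y : normedModType K) (P : X -> Y)
    (L : sym_proj_tensor m X -> Y) : Prop :=
  [/\ linear L, continuous L & forall x, L (proj_diag m x) = P x].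

(* P_L, selected as the unique map satisfying [is_linearization]. The default
   value 0 is not used when P is a continuous m-homogeneous polynomial into a
   Banach space. *)
Definition linearization (m : nat) (X Y : normedModType K) (P : X -> Y) :
    sym_proj_tensor m X -> Y :=
  xget (fun=> 0) [set L | is_linearization P L].

(* The existence of a basis of d vectors makes N a linear subspace. *)
Definition is_subspace_of_dim (Y : lmodType K) (N : set Y) (d : nat) : Prop :=
  exists b : 'I_d -> Y,
    (forall c : 'I_d -> K, \sum_i c i *: b i = 0 -> forall i, c i = 0) /\
    N = [set \sum_i c i *: b i | c in [set: 'I_d -> K]].

Definition closed_unit_ball (X : normedModType K) : set X :=
  [set x | `|x| <= 1].

Definition kolmogorov (n : nat) (X Y : normedModType K) (f : X -> Y) : R :=
  inf [set e : R | 0 < e /\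
    exists (N : set Y) (d : nat),
      [/\ is_subspace_of_dim N d, (d < n)%N
        & f @` closed_unit_ball (X := X) `<=`
          [set y + of_real e *: u | y in N & u in closed_unit_ball (X := Y)]]].

End Polynomials.

Arguments linearization {R k} m {X Y} P.

(* Main.v *)
(* Since P x = P_L (x (x) ... (x) x) and the diagonal tensor of a vector of the
   unit ball lies in the unit ball, every radius admissible for P_L is admissible
   for P. Conversely, if P maps the unit ball into N + e B, then by homogeneity P_L
   maps a combination of diagonal tensors of total weight w into N + w e B; such
   combinations of weight close to 1 are dense in the unit ball of the completed
   tensor product and P_L is bounded, so every e' > e is admissible for P_L. The
   linearization is well defined on the algebraic tensor power because linear
   functionals, not necessarily continuous, separate the points of Y, and it
   extends to the completion because Y is complete. *)

Require Import Defs.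
From mathcomp Require Import all_boot all_order all_algebra.
From mathcomp Require Import all_classical all_reals all_analysis.

Set Implicit Arguments.
Unset Strict Implicit.
Unset Printing Implicit Defensive.

Import Order.TTheory GRing.Theory Num.Theory.
Import numFieldNormedType.Exports.

Local Open Scope classical_set_scope.
Local Open Scope ring_scope.

(** * Algebraic preliminaries: separating functionals, diagonals of multilinear maps *)

(** A maximal subspace [W] avoiding [y] is a complement of the line spanned by [y]; [f] is the
    coordinate along [y]. *)
Lemma separating_functional (K : fieldType) (V : lmodType K) (y : V) :
  y != 0 -> exists2 f : V -> K^o, linear f & f y != 0.
Proof.
move=> y0.
pose P (W : set V) :=
  ~ W y /\ forall a u v, W u -> W v -> W (a *: u + v).
have [W [[Wy Wlin] Wmax]] : exists W, P W /\ forall B, W `<` B -> ~ P B.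
  apply: Zorn_bigcup => F FP Ftot; split; first by case=> A /FP[Ay _] /Ay.
  move=> a u v [A FA Au] [B FB Bv].
  by have [/(_ _ Au) Bu|/(_ _ Bv) Av] := Ftot A B FA FB;
    [exists B | exists A] => //; apply: (FP _ _).2.
(* The predicate [P] admits the empty set, the union of the empty chain; maximality against the zero
   subspace rules it out for [W]. *)
have W0 : W 0.
  apply: contrapT => nW0; have Wempty u : ~ W u.
    by move=> Wu; apply: nW0; rewrite -(addNr u) -scaleN1r; exact: Wlin.
  apply: (Wmax [set 0]).
    by split=> [u /Wempty//|/(_ 0 erefl)].
  split=> [/= /eqP|a u v -> ->]; first by rewrite (negbTE y0).
  by rewrite scaler0 addr0.
have WZ a u : W u -> W (a *: u) by move=> Wu; rewrite -[_ *: _]addr0; exact: Wlin.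
(* Otherwise [W] + K[v] would be a strictly larger subspace that still avoids [y]. *)
have decomp v : exists c, W (v - c *: y).
  have [Wv|nWv] := pselect (W v); first by exists 0; rewrite scale0r subr0.
  apply: contrapT => nc.
  apply: (Wmax [set u | exists a, W (u - a *: v)]).
    split=> [u Wu|/(_ v)]; first by exists 0; rewrite scale0r subr0.
    by move=> sub; apply/nWv/sub; exists 1; rewrite scale1r subrr.
  split=> [[a Wa]|a u w [b Wb] [c Wc]].
    apply: nc; exists a^-1.
    have a0 : a != 0.
      by apply: contra_notN Wy => /eqP a0; move: Wa; rewrite a0 scale0r subr0.
    have := WZ (- a^-1) _ Wa.
    by rewrite scalerBr scalerA mulNr mulVf // scaleN1r opprK scaleNr addrC.
  exists (a * b + c).
  have := Wlin a _ _ Wb Wc.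
  by rewrite scalerBr scalerA addrACA -opprD -scalerDl.
have [f Wf] := choice decomp.
(* Two distinct coefficients would put a nonzero multiple of [y] in [W]. *)
have f_unique v c : W (v - c *: y) -> f v = c.
  move=> Wc; apply: contrapT => /eqP fc; apply: Wy.
  have := Wlin (-1) _ _ (Wf v) Wc; rewrite scaleN1r opprB subrKA.
  rewrite -scalerBl => /(WZ (f v - c)^-1).
  by rewrite scalerA mulVf ?subr_eq0 // scale1r.
exists f => [a u v|]; last first.
  by rewrite (f_unique y 1) ?oner_eq0 // scale1r subrr.
apply: f_unique; have := Wlin a _ _ (Wf u) (Wf v).
by rewrite scalerBr scalerA addrACA -opprD -scalerDl.
Qed.

Lemma multilinear_diagZ (K : numFieldType) (m : nat) (X Y : lmodType K)
    (A : ('I_m -> X) -> Y) : multilinear A ->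
  forall c x, A (fun=> c *: x) = c ^+ m *: A (fun=> x).
Proof.
(* Only the first [j] arguments of [v j] are scaled, so each increment of [j] changes one coordinate
   and releases one factor [c]. *)
move=> mA c x; pose v (j : nat) (i : 'I_m) := if (i < j)%N then c *: x else x.
have step j : (j <= m)%N -> A (v j) = c ^+ j *: A (fun=> x).
  elim: j => [_|j IHj jm]; first by rewrite scale1r; congr A; apply/funext.
  pose i0 := Ordinal jm.
  have vS : v j.+1 = dfwith (v j) i0 (c *: x).
    apply/funext => i; case: dfwithP => [|i' ne]; first by rewrite /v /= ltnSn.
    rewrite /v ltnS leq_eqVlt.
    by rewrite -(inj_eq val_inj) eq_sym in ne; rewrite (negbTE ne).
  have vE : v j = dfwith (v j) i0 x.
    by apply/funext => i; case: dfwithP => //; rewrite /v /= ltnn.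
  have := GRing.scalable_linear (mA i0 (v j)) c x.
  by rewrite /= -vS -vE (IHj (ltnW jm)) scalerA -exprS.
rewrite -step //; congr A; apply/funext => i.
by rewrite /v ltn_ord.
Qed.

(** * Real-valued norms and bounds for homogeneous maps *)

Section RealNorms.
Variables (R : realType) (k : scalar_kind).
Local Notation K := (scalars R k).

Lemma of_real1 : of_real 1 = 1 :> K.
Proof. by case: k. Qed.

Lemma rnormD (V : normedZmodType K) (x y : V) : rnorm (x + y) <= rnorm x + rnorm y.
Proof. by rewrite -(of_real_le k) of_realD !rnormE ler_normD. Qed.

Lemma rnormN (V : normedZmodType K) (x : V) : rnorm (- x) = rnorm x.
Proof. by rewrite /rnorm normrN. Qed.

Lemma rnormBC (V : normedZmodType K) (x y : V) : rnorm (x - y) = rnorm (y - x).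
Proof. by rewrite /rnorm distrC. Qed.

Lemma rnorm_trans (V : normedZmodType K) (y x z : V) :
  rnorm (x - z) <= rnorm (x - y) + rnorm (y - z).
Proof. by rewrite -(subrKA y) rnormD. Qed.

Lemma rnormZ (V : normedModType K) (a : K) (x : V) :
  rnorm (a *: x) = rnorm a * rnorm x.
Proof. by apply: (can_inj (@of_realK R k)); rewrite of_realM !rnormE normrZ. Qed.

Lemma rnormX (a : K) (j : nat) : rnorm (a ^+ j) = rnorm a ^+ j.
Proof.
by elim: j => [|j IHj]; rewrite ?rnorm_scalar1 // !exprS rnorm_scalarM IHj.
Qed.

Lemma rnorm_eq0 (V : normedZmodType K) (x : V) : (rnorm x == 0) = (x == 0).
Proof.
by rewrite -(inj_eq (can_inj (@of_realK R k))) rnormE of_real0 normr_eq0.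
Qed.

Lemma rnorm_of_real (r : R) : 0 <= r -> rnorm (of_real r : K) = r.
Proof.
by move=> r0; rewrite /rnorm ger0_norm ?of_realK // -(of_real0 R k) of_real_le.
Qed.

Lemma rnorm_lim0 (V : normedZmodType K) (x : V) (c : R) :
  (forall e, 0 < e -> rnorm x <= c * e) -> x = 0.
Proof.
move=> H; apply/eqP; rewrite -rnorm_eq0 eq_le rnorm_ge0 andbT.
have c1 : 0 < `|c| + 1 by rewrite ltr_wpDl.
apply/ler_addgt0Pr => e e0; rewrite add0r.
have := H (e / (`|c| + 1)) (divr_gt0 e0 c1) => /le_trans; apply.
rewrite mulrA ler_pdivrMr // mulrC ler_pM2l //.
by rewrite (le_trans (ler_norm _)) // lerDl.
Qed.

(** Continuity at 0 bounds [f] on a small ball, and homogeneity carries the bound to all [x]. It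
    serves for [P] in degree [m] and for its linearization in degree 1. *)
Lemma homogeneous_bounded (m : nat) (X Y : normedModType K) (f : X -> Y) :
  {for 0, continuous f} -> (forall c x, f (c *: x) = c ^+ m *: f x) ->
  exists2 C : R, 0 <= C & forall x, rnorm (f x) <= C * rnorm x ^+ m.
Proof.
move=> /cvgrPdist_lt/(_ 1 ltr01)/nbhs_norm0P[d /= d0 df] fZ.
(* Halving puts the closed ball of radius [d'] inside the open ball of radius [d]. *)
pose d' : R := re_part d / 2.
have dE : of_real (re_part d) = d by rewrite re_partK // ltW.
have rd0 : 0 < re_part d by rewrite -(of_real_lt k) dE of_real0.
have d'0 : 0 < d' by rewrite divr_gt0.
pose M : R := rnorm (f 0) + 1.
have M0 : 0 <= M by rewrite addr_ge0 ?rnorm_ge0.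
have fM x : rnorm x <= d' -> rnorm (f x) <= M.
  move=> xd; have : rnorm (f 0 - f x) <= 1.
    rewrite -(of_real_le k) rnormE of_real1 ltW //.
    apply: df => /=; rewrite -dE -rnormE of_real_lt (le_lt_trans xd) //.
    by rewrite ltr_pdivrMr // ltr_pMr // ltr1n.
  move=> H; rewrite -[f x](subKr (f 0)) (le_trans (rnormD _ _)) // rnormN.
  by rewrite lerD2l.
exists (M * d'^-1 ^+ m) => [|x].
  by rewrite mulr_ge0 // exprn_ge0 // invr_ge0 ltW.
rewrite -mulrA -exprMn; have [->|x0] := eqVneq x 0.
  (* Homogeneity with factor 0, in a form that also covers [m] = 0. *)
  have -> : rnorm (f 0) = rnorm (f 0) * 0 ^+ m.
    by rewrite -{1}(scale0r (0 : X)) fZ rnormZ rnormX rnorm0 mulrC.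
  by rewrite rnorm0 mulr0 ler_wpM2r ?exprn_ge0 // lerDl.
have rx0 : 0 < rnorm x by rewrite lt_neqAle rnorm_ge0 eq_sym rnorm_eq0 x0.
pose c : R := d' / rnorm x.
have c0 : 0 < c by rewrite divr_gt0.
have := fM (of_real c *: x).
rewrite fZ !rnormZ rnormX rnorm_of_real ?(ltW c0) // divfK ?gt_eqF //.
move=> /(_ (lexx _)).
rewrite mulrC -ler_pdivlMr ?exprn_gt0 // -exprVn invf_div => /le_trans; apply.
by rewrite [rnorm x / d']mulrC.
Qed.

End RealNorms.

(** * Extension of bounded linear maps to the completion *)

Section Extension.
Variables (R : realType) (k : scalar_kind).
Local Notation K := (scalars R k).
Variables (V : lmodType K) (p : seminorm V) (Y : completeNormedModType K).
Variables (T : V -> Y) (C : R).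
Hypotheses (T_linear : linear T) (C0 : 0 <= C).
Hypothesis T_bounded : forall x, rnorm (T x) <= C * p x.

Let TB x y : T (x - y) = T x - T y.
Proof. exact: (GRing.zmod_morphism_linear T_linear). Qed.

(** The value is the limit of [T] along a Cauchy sequence representing [q]. The estimate against
    every [x] determines it, so the properties of the extension follow without returning to
    sequences. *)
Lemma dense_extension_value (q : completion p) :
  exists y, forall x, rnorm (y - T x) <= C * rnorm (q - to_completion p x).
Proof.
pose u : cauchy_seq p := repr (q : Quotient.quot (null_pred p)).
(* Since [C] may be 0, the divisions below use [C + 1]. *)
have C1 : 0 < C + 1 by rewrite ltr_wpDl.
have ofe (e : K) : 0 < e -> exists2 r : R, 0 < r & e = of_real r.
  move=> e0; have eE : of_real (re_part e) = e by rewrite re_partK // ltW.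
  by exists (re_part e) => //; rewrite -(of_real_lt k) eE of_real0.
have cT : cvg ((fun i => T (u i)) @ \oo).
  apply/cauchy_cvgP/cauchy_exP => _ /ofe[e e0 ->].
  have [N HN] := cauchy_seqP u (divr_gt0 e0 C1).
  exists (T (u N)); exists N => // i /= Ni.
  rewrite -ball_normE /= -rnormE of_real_lt -TB (le_lt_trans (T_bounded _)) //.
  apply: (@le_lt_trans _ _ ((C + 1) * p (u N - u i))).
    by rewrite ler_wpM2r ?seminorm_ge0 // lerDl.
  by rewrite mulrC -ltr_pdivlMr // HN.
have /cvg_ex[y /cvgrPdist_lt yT] := cT.
exists y => x; apply/ler_addgt0Pr => e e0.
have e20 : 0 < e / 2 by rewrite divr_gt0.
have of_e20 : 0 < of_real (e / 2) :> K by rewrite -(of_real0 R k) of_real_lt.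
have [N HN] := class_cvg u (divr_gt0 e20 C1).
have [N' _ HN'] := yT _ of_e20.
pose i := maxn N N'.
have := HN' i (leq_maxr _ _); rewrite /= -rnormE of_real_lt => yi.
have := HN i (leq_maxl _ _); rewrite repK => qi.
rewrite (le_trans (rnorm_trans (T (u i)) _ _)) // (splitr e) addrCA.
rewrite lerD ?(ltW yi) // -TB (le_trans (T_bounded _)) //.
rewrite -(to_completion_norm p) raddfB /=.
apply: (le_trans (ler_wpM2l C0 (rnorm_trans q _ _))).
rewrite mulrDr [leRHS]addrC lerD2r rnormBC.
apply: (le_trans (ler_wpM2l C0 qi)).
by rewrite mulrA ler_pdivrMr // mulrC ler_pM2l // lerDl.
Qed.

Lemma dense_extension : exists L : completion p -> Y,
  [/\ linear L, forall q, rnorm (L q) <= C * rnorm q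
    & forall x, L (to_completion p x) = T x].
Proof.
have [L HL] := choice dense_extension_value.
have T0 : T 0 = 0 by rewrite -(subrr 0) TB subrr.
exists L; split=> [a q r|q|x].
(* Both sides of the linearity equation lie within C(|a| + 1)e of [T (a *: x + y)], for [x], [y]
   approximating [q], [r] within [e]. *)
- apply/eqP; rewrite -subr_eq0; apply/eqP.
  apply: (@rnorm_lim0 _ _ _ _ (2 * C * (rnorm a + 1))) => e e0.
  have [x qx] := to_completion_dense q e0.
  have [y ry] := to_completion_dense r e0.
  have Te : T (a *: x + y) = a *: T x + T y by exact: T_linear.
  rewrite (le_trans (rnorm_trans (T (a *: x + y)) _ _)) //.
  have H : rnorm (a *: (q - to_completion p x) + (r - to_completion p y))
      <= (rnorm a + 1) * e.
    rewrite (le_trans (rnormD _ _)) // rnormZ mulrDl mul1r lerD //.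
    by rewrite ler_wpM2l ?rnorm_ge0.
  rewrite -!mulrA mulr_natl mulr2n; apply: lerD.
    apply: (le_trans (HL _ _)); rewrite ler_wpM2l //.
    apply: le_trans H; by rewrite linearP scalerBr opprD addrACA.
  rewrite rnormBC Te.
  have -> : a *: L q + L r - (a *: T x + T y) = a *: (L q - T x) + (L r - T y).
    by rewrite scalerBr opprD addrACA.
  rewrite (le_trans (rnormD _ _)) // rnormZ mulrDl mul1r mulrDr lerD //.
    rewrite mulrCA ler_wpM2l ?rnorm_ge0 // (le_trans (HL _ _)) //.
    by rewrite ler_wpM2l.
  by rewrite (le_trans (HL _ _)) // ler_wpM2l.
- by have := HL q 0; rewrite raddf0 T0 !subr0.
- apply/eqP; rewrite -subr_eq0 -rnorm_eq0 eq_le rnorm_ge0 andbT.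
  by have := HL (to_completion p x) x; rewrite subrr rnorm0 mulr0.
Qed.

End Extension.

(** * Existence of the linearization *)

Section Linearization.
Variables (R : realType) (k : scalar_kind).
Local Notation K := (scalars R k).
Variables (m : nat).

Lemma rnorm_lipschitz_continuous (X Y : normedModType K) (C : R) (f : X -> Y) :
  0 <= C -> (forall x y, rnorm (f x - f y) <= C * rnorm (x - y)) -> continuous f.
Proof.
move=> C0 fC x; apply/cvgrPdist_lt => e e0.
have eE : of_real (re_part e) = e by rewrite re_partK // ltW.
have re0 : 0 < re_part e by rewrite -(of_real_lt k) eE of_real0.
have C1 : 0 < C + 1 by rewrite ltr_wpDl.
have d0 : 0 < of_real (re_part e / (C + 1)) :> K.
  by rewrite -(of_real0 R k) of_real_lt divr_gt0.
near=> y; rewrite -eE -rnormE of_real_lt (le_lt_trans (fC _ _)) //.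
have xy : rnorm (x - y) < re_part e / (C + 1).
  rewrite -(of_real_lt k) rnormE; near: y.
  exact: (cvgrPdist_lt id x).1 (@cvg_id _ (nbhs x)) _ d0.
apply: (@le_lt_trans _ _ ((C + 1) * rnorm (x - y))).
  by rewrite ler_wpM2r ?rnorm_ge0 // lerDl.
by rewrite mulrC -ltr_pdivlMr.
Unshelve. all: by end_near. Qed.

(* Composing with a linear functional that separates the value of the right-hand
   side from 0 turns A into a scalar form, on which the two sides are tested. *)
Lemma symtensor_sum_eq0 (X : normedModType K) (Y : lmodType K)
    (A : ('I_m -> X) -> Y) (s : seq (K * X)) : multilinear A ->
  \sum_(t <- s) t.1 *: diag m t.2 = 0 ->
  \sum_(t <- s) t.1 *: A (fun=> t.2) = 0.
Proof.
move=> mA s0; apply: contrapT => /eqP/separating_functional[f f_lin].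
have fD u v : f (u + v) = f u + f v.
  by have := f_lin 1 u v; rewrite !scale1r.
have f0 : f 0 = 0 by apply: (addrI (f 0)); rewrite -fD !addr0.
have fZ a u : f (a *: u) = a * f u.
  by have := f_lin a u 0; rewrite f0 !addr0.
have mfA : @multilinear K m X K^o (fun v => f (A v)).
  by move=> i v a x y /=; rewrite (mA i v a x y) f_lin.
rewrite (big_morph f fD f0).
have := congr1 val s0; rewrite raddf_sum => /(congr1 (@^~ (MultilinearForm mfA))).
rewrite fct_sumE /= => E.
case/negP; apply/eqP; rewrite -[RHS]E.
by apply: eq_bigr => t _; rewrite fZ.
Qed.

Lemma linearization_exists (X : normedModType K) (Y : completeNormedModType K)
    (P : X -> Y) : cont_homog_poly m P -> exists L, @is_linearization R k m X Y P L.
Proof.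
case=> A [mA cA PA].
have PZ c x : P (c *: x) = c ^+ m *: P x by rewrite !PA multilinear_diagZ.
have cP : {for 0, continuous P}.
  (* [P] is [A] after the diagonal embedding, which is continuous at 0 for the product topology
     because each coordinate is the identity. *)
  rewrite (_ : P = (A : {ptws 'I_m -> X} -> Y) \o (fun x => (fun=> x))); last first.
    exact/funext.
  apply: continuous_comp; last exact: cA.
  have diag_cvg : {ptws, (fun x : X => (fun=> x) : 'I_m -> X) @ nbhs (0 : X)
      --> (fun=> 0)}.
    apply/cvg_sup => i; apply/cvg_image.
      by rewrite eqEsubset; split=> // x _; exists (fun=> x).
    move=> W nW /=; exists (@^~ i @^-1` W) => //.
    by rewrite image_preimage // eqEsubset; split=> // x _; exists (fun=> x).
  exact: diag_cvg.
have [C C0 PC] := homogeneous_bounded cP PZ.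
have [dec decE] := choice (@symtensor_decomp R k m X).
(* [T] is read off a chosen decomposition; [T_sum] shows that every decomposition gives the same
   value. *)
pose T (z : symtensor m X) : Y := \sum_(t <- dec z) t.1 *: P t.2.
have T_sum (s : seq (K * X)) (z : symtensor m X) :
    z = \sum_(t <- s) t.1 *: diag m t.2 -> T z = \sum_(t <- s) t.1 *: P t.2.
  move=> zs; apply/eqP; rewrite -subr_eq0; apply/eqP.
  (* The chosen decomposition followed by the negative of [s] represents [z] - [z] = 0. *)
  have := @symtensor_sum_eq0 X Y A (dec z ++ [seq (- t.1, t.2) | t <- s]) mA.
  rewrite !big_cat !big_map /= -decE.
  under eq_bigr do rewrite scaleNr.
  rewrite sumrN -zs subrr => /(_ erefl).
  under [X in _ + X = _]eq_bigr do rewrite scaleNr -PA.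
  under eq_bigr do rewrite -PA.
  by rewrite sumrN.
have T_linear : linear T.
  move=> a z w.
  rewrite (T_sum ([seq (a * t.1, t.2) | t <- dec z] ++ dec w)).
    rewrite big_cat big_map scaler_sumr; congr (_ + _).
    by apply: eq_bigr => t _; rewrite scalerA.
  rewrite big_cat big_map {1}(decE z) {1}(decE w) scaler_sumr; congr (_ + _).
  by apply: eq_bigr => t _; rewrite scalerA.
have T_bounded z : rnorm (T z) <= C * proj_seminorm m X z.
  apply/ler_addgt0Pr => e e0.
  have C1 : 0 < C + 1 by rewrite ltr_wpDl.
  (* A decomposition of nearly minimal cost, to which the bound on [P] is applied term by term. *)
  have [s zs lts] := proj_norm_lt z (divr_gt0 e0 C1).
  rewrite (T_sum _ _ zs).
  apply: (@le_trans _ _ (C * \sum_(t <- s) rnorm t.1 * rnorm t.2 ^+ m)).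
    rewrite mulr_sumr.
    elim: s {zs lts} => [|t s IHs]; first by rewrite !big_nil rnorm0.
    rewrite !big_cons (le_trans (rnormD _ _)) // lerD // rnormZ mulrCA.
    by rewrite ler_wpM2l ?rnorm_ge0.
  apply: (le_trans (ler_wpM2l C0 (ltW lts))).
  rewrite mulrDr lerD2l mulrA ler_pdivrMr // mulrC ler_pM2l //.
  by rewrite lerDl.
have [L [L_lin L_bnd LT]] := dense_extension T_linear C0 T_bounded.
exists L; split=> //.
  apply: (rnorm_lipschitz_continuous C0) => q r.
  by rewrite -(GRing.zmod_morphism_linear L_lin).
by move=> x; rewrite /proj_diag LT (T_sum [:: (1, x)]) ?big_seq1 ?scale1r //.
Qed.

End Linearization.

(** * Neighbourhoods of finite-dimensional subspaces and admissible radii *)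

Section Thickening.
Variables (R : realType) (k : scalar_kind).
Local Notation K := (scalars R k).

(** This is [N] plus [r] times the closed unit ball, phrased by distances so that radii, 0 included,
    combine through the triangle inequality. *)
Definition thickening (Y : normedModType K) (N : set Y) (r : R) : set Y :=
  [set y | exists2 v, N v & rnorm (y - v) <= r].

Lemma subspace0 (Y : lmodType K) (N : set Y) d : is_subspace_of_dim N d -> N 0.
Proof.
case=> b [_ ->]; exists (fun=> 0) => //.
by rewrite big1 // => i _; rewrite scale0r.
Qed.

Lemma subspace_lin (Y : lmodType K) (N : set Y) d : is_subspace_of_dim N d ->
  forall a u v, N u -> N v -> N (a *: u + v).
Proof.
case=> b [_ ->] a _ _ [c _ <-] [c' _ <-]; exists (fun i => a * c i + c' i) => //.
rewrite scaler_sumr -big_split; apply: eq_bigr => i _.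
by rewrite /= scalerDl scalerA.
Qed.

Lemma subspace_zero (Y : lmodType K) : is_subspace_of_dim [set (0 : Y)] 0.
Proof.
exists (fun=> 0); split=> [c _ []//|]; rewrite eqEsubset; split=> y /=.
  by move=> ->; exists (fun=> 0) => //; rewrite big_ord0.
by case=> c _ <-; rewrite big_ord0.
Qed.

Lemma thickeningE (Y : normedModType K) (N : set Y) (e : R) : 0 < e ->
  [set y + of_real e *: u | y in N & u in closed_unit_ball (X := Y)]
    = thickening N e.
Proof.
move=> e0; have oe0 : of_real e != 0 :> K.
  by rewrite -(of_real0 R k) (inj_eq (can_inj (@of_realK R k))) gt_eqF.
rewrite eqEsubset; split=> [_ [y Ny [u u1 <-]]|y [v Nv yv]].
  exists y => //; rewrite addrAC subrr add0r rnormZ (rnorm_of_real _ (ltW e0)).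
  by rewrite ler_piMr ?(ltW e0) // -(of_real_le k) rnormE of_real1.
exists v => //; exists ((of_real e)^-1 *: (y - v)); last first.
  by rewrite scalerA divff // scale1r addrCA subrr addr0.
rewrite /closed_unit_ball /= normrZ normfV ler_pdivrMl ?normr_gt0 // mulr1.
by rewrite -!rnormE of_real_le (rnorm_of_real _ (ltW e0)).
Qed.

Lemma thickening_le (Y : normedModType K) (N : set Y) (r r' : R) :
  r <= r' -> thickening N r `<=` thickening N r'.
Proof. by move=> rr' y [v Nv yv]; exists v => //; exact: le_trans rr'. Qed.

Lemma thickening_near (Y : normedModType K) (N : set Y) (r r' : R) (y z : Y) :
  thickening N r y -> rnorm (z - y) <= r' -> thickening N (r + r') z.
Proof.
move=> [v Nv yv] zy; exists v => //.
by rewrite (le_trans (rnorm_trans y _ _)) // addrC lerD.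
Qed.

(** The approximants combine inside the subspace [N], and the errors add up with weights |a i|. *)
Lemma thickening_sum (Y : normedModType K) (N : set Y) d (I : Type)
    (s : seq I) (a : I -> K) (r : I -> R) (y : I -> Y) :
  is_subspace_of_dim N d -> (forall i, thickening N (r i) (y i)) ->
  thickening N (\sum_(i <- s) rnorm (a i) * r i) (\sum_(i <- s) a i *: y i).
Proof.
move=> sN sy; elim: s => [|i s [v Nv yv]].
  by exists 0; rewrite ?big_nil ?subrr ?rnorm0 //; exact: subspace0 sN.
have [w Nw yw] := sy i.
exists (a i *: w + v); first exact: subspace_lin sN _ _ _ Nw Nv.
rewrite !big_cons opprD addrACA -scalerBr (le_trans (rnormD _ _)) // lerD //.
by rewrite rnormZ ler_wpM2l ?rnorm_ge0.
Qed.

Definition kolmogorov_radii (n : nat) (X Y : normedModType K) (f : X -> Y) : set R :=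
  [set e | 0 < e /\ exists (N : set Y) (d : nat),
    [/\ is_subspace_of_dim N d, (d < n)%N
      & forall x, rnorm x <= 1 -> thickening N e (f x)]].

Lemma kolmogorovE (n : nat) (X Y : normedModType K) (f : X -> Y) :
  kolmogorov n f = inf (kolmogorov_radii n f).
Proof.
have ballE (x : X) : closed_unit_ball x <-> rnorm x <= 1.
  by rewrite /closed_unit_ball /= -rnormE -(of_real1 R k) of_real_le.
congr inf; apply/seteqP; split=> e [e0 [N [d [sN dn fN]]]]; split=> //;
    exists N, d; split=> //.
  by move=> x /ballE x1; rewrite -thickeningE //; apply: fN; exists x.
by rewrite thickeningE // => _ [x /ballE x1 <-]; exact: fN.
Qed.

Lemma kolmogorov_radii_lbound (n : nat) (X Y : normedModType K) (f : X -> Y) :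
  has_lbound (kolmogorov_radii n f).
Proof. by exists 0 => e [/ltW]. Qed.

(** The zero subspace, of dimension 0 < [n], serves any bounded map; the radius [C + 1] is positive
    even when [C] = 0. This keeps [inf] off its default value on the empty set. *)
Lemma kolmogorov_radii_nonempty (n : nat) (X Y : normedModType K) (f : X -> Y)
    (C : R) : (0 < n)%N -> 0 <= C -> (forall x, rnorm x <= 1 -> rnorm (f x) <= C) ->
  kolmogorov_radii n f !=set0.
Proof.
move=> n0 C0 fC; exists (C + 1); split; first by rewrite ltr_wpDl.
exists [set 0], 0%N; split=> //; first exact: subspace_zero.
move=> x /fC xC; exists 0 => //.
by rewrite subr0 (le_trans xC) // lerDl.
Qed.

End Thickening.

(** * Comparison of the radii of a polynomial and of its linearization *)

Section Comparison.
Variables (R : realType) (k : scalar_kind).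
Local Notation K := (scalars R k).
Variables (m n : nat) (X Y : completeNormedModType K) (P : X -> Y).
Variable L : sym_proj_tensor m X -> Y.
Hypotheses (m0 : (0 < m)%N) (PZ : forall c x, P (c *: x) = c ^+ m *: P x).
Hypothesis L_linearization : is_linearization P L.

Let LB q r : L (q - r) = L q - L r.
Proof. by case: L_linearization => /GRing.zmod_morphism_linear. Qed.

Lemma linearization_bounded :
  exists2 C : R, 0 <= C & forall q, rnorm (L q) <= C * rnorm q.
Proof.
case: L_linearization => L_lin L_cont _.
have [C C0 LC] := homogeneous_bounded (L_cont 0)
  (GRing.scalable_linear L_lin : forall c x, L (c *: x) = c ^+ 1 *: L x).
by exists C.
Qed.

Lemma rnorm_proj_diag_le (x : X) : rnorm (proj_diag m x) <= rnorm x ^+ m.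
Proof.
rewrite /proj_diag to_completion_norm.
apply: (le_trans (@proj_norm_le _ _ _ _ _ [:: (1, x)] _)).
  by rewrite big_seq1 scale1r.
by rewrite big_seq1 rnorm_scalar1 mul1r.
Qed.

Lemma radii_linearization_sub :
  kolmogorov_radii n L `<=` kolmogorov_radii n P.
Proof.
move=> e [e0 [N [d [sN dn LN]]]]; split=> //; exists N, d; split=> // x x1.
case: L_linearization => _ _ <-; apply: LN.
by rewrite (le_trans (rnorm_proj_diag_le x)) // exprn_ile1 ?rnorm_ge0.
Qed.

(** The estimate at [x] divided by its norm is scaled back by the [m]-th power of that norm; at [x]
    = 0, positivity of [m] gives [P 0] = 0. *)
Lemma thickening_homog (N : set Y) d (e : R) : is_subspace_of_dim N d ->
  (forall x, rnorm x <= 1 -> thickening N e (P x)) ->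
  forall x, thickening N (e * rnorm x ^+ m) (P x).
Proof.
move=> sN PN x; have [->|x0] := eqVneq x 0.
  exists 0; first exact: subspace0 sN.
  have -> : P 0 = 0 by rewrite -(scale0r (0 : X)) PZ expr0n gtn_eqF // scale0r.
  by rewrite subr0 !rnorm0 expr0n gtn_eqF // mulr0.
have rx0 : rnorm x != 0 by rewrite rnorm_eq0.
have := PN (of_real (rnorm x)^-1 *: x).
rewrite rnormZ rnorm_of_real ?invr_ge0 ?rnorm_ge0 // mulVf // => /(_ (lexx _)) Px.
(* A one-term sum performs the scaling of the neighbourhood. *)
have := thickening_sum [:: tt] (fun=> of_real (rnorm x) ^+ m) sN (fun=> Px).
rewrite !big_seq1 -PZ scalerA -of_realM divff // of_real1 scale1r rnormX mulrC.
by rewrite rnorm_of_real ?rnorm_ge0.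
Qed.

(* A tensor z within delta of the closed unit ball is a combination of diagonal
   tensors of total weight at most 1 + 2 delta, hence is sent into N up to
   (1 + 2 delta) e; passing from z back to a point of the ball costs C delta. The
   choice of delta makes the two errors add up to e'. *)
Lemma radii_gt (e e' : R) : kolmogorov_radii n P e -> e < e' ->
  kolmogorov_radii n L e'.
Proof.
move=> [e0 [N [d [sN dn PN]]]] ee'; split; first exact: lt_trans ee'.
exists N, d; split=> // q q1.
have [C C0 LC] := linearization_bounded.
have M0 : 0 < 2 * e + C by rewrite ltr_wpDr // mulr_gt0.
pose delta := (e' - e) / (2 * e + C).
have delta0 : 0 < delta by rewrite divr_gt0 ?subr_gt0.
have [z qz] := to_completion_dense q delta0.
have [s zs lts] := proj_norm_lt z delta0.
(* One [delta] is the distance from [z] to [q]; the second is the slack in the cost of [s]. *)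
have z1 : proj_norm z <= 1 + delta.
  rewrite -[proj_norm z](to_completion_norm (proj_seminorm m X)).
  rewrite -[to_completion _ _](subKr q) (le_trans (rnormD _ _)) // rnormN.
  by rewrite lerD.
have Lz : L (to_completion (proj_seminorm m X) z) = \sum_(t <- s) t.1 *: P t.2.
  case: L_linearization => L_lin _ LP.
  have LD u v : L (u + v) = L u + L v by have := L_lin 1 u v; rewrite !scale1r.
  have L0 : L 0 = 0 by rewrite -(subrr 0) LB subrr.
  rewrite zs raddf_sum (big_morph L LD L0); apply: eq_bigr => t _.
  rewrite -LP -(GRing.scalable_linear L_lin t.1); congr L.
  exact: (GRing.scalable_linear (to_completion_linear _)).
have Nz : thickening N (e * (1 + 2 * delta))
    (L (to_completion (proj_seminorm m X) z)).
  rewrite Lz; apply: thickening_le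
    (thickening_sum s fst sN (fun t => thickening_homog sN PN t.2)).
  under eq_bigr do rewrite mulrCA.
  rewrite -mulr_sumr ler_pM2l // (le_trans (ltW lts)) //.
  by rewrite mulr_natl mulr2n addrA lerD2r.
apply: (@thickening_le _ _ _ _ (e * (1 + 2 * delta) + C * delta)).
  rewrite mulrDr mulr1 -addrA -lerBrDl mulrCA mulrA -mulrDl.
  by rewrite mulrC divfK // gt_eqF.
apply: (thickening_near Nz); rewrite -LB (le_trans (LC _)) //.
by rewrite ler_wpM2l.
Qed.

End Comparison.

Theorem proposition4p7 (R : realType) (k : scalar_kind) (m n : nat)
    (X Y : completeNormedModType (scalars R k)) (P : X -> Y)
    (hm : (0 < m)%N) (hn : (0 < n)%N) (hP : cont_homog_poly m P) :
  kolmogorov n P = kolmogorov n (linearization m P).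
Proof.
(* Existence of a linearization ensures that [xget] returns one rather than its default value. *)
have PL : is_linearization P (linearization m P).
  by have [L PL] := linearization_exists hP; exact: (xgetPex _ (ex_intro _ L PL)).
have PZ c x : P (c *: x) = c ^+ m *: P x.
  by case: hP => A [mA _ PA]; rewrite !PA multilinear_diagZ.
have [C C0 LC] := linearization_bounded PL.
have rL : kolmogorov_radii n (linearization m P) !=set0.
  apply: (kolmogorov_radii_nonempty hn C0) => q q1.
  by rewrite (le_trans (LC q)) // ler_piMr.
have rLP := @radii_linearization_sub _ _ m n _ _ _ _ PL.
rewrite !kolmogorovE; apply/eqP; rewrite eq_le; apply/andP; split.
  apply: lb_le_inf => // e /rLP; apply: ge_inf.
  exact: kolmogorov_radii_lbound.
apply: lb_le_inf; first by case: rL => e /rLP; exists e.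
(* A radius [e] of [P] yields the radius [e] + [e'] of the linearization for every [e'] > 0, which
   suffices for the infimum. *)
move=> e re; apply/ler_addgt0Pr => e' e'0; apply: ge_inf.
  exact: kolmogorov_radii_lbound.
by apply: (radii_gt hm PZ PL re); rewrite ltrDl.
Qed.
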